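(* Let $\mu\ne0$, let $\tau_L(\varepsilon),\delta_L(\varepsilon),\tau_R(\varepsilon),\delta_R(\varepsilon)$ vary smoothly with a real parameter $\varepsilon$ near $0$, let $\mathcal{X},\mathcal{Y}$ be words on $\{L,R\}$ with $\mathcal{X}$ primitive and $\mathcal{X}_0\ne\mathcal{Y}_0$, and let $\mathcal{S}[k]=\mathcal{X}^k\mathcal{Y}$. Suppose that when $\varepsilon=0$ there exist infinitely many $k\ge1$ for which the border-collision normal form has a unique, admissible, stable $\mathcal{S}[k]$-cycle that has no points on the switching manifold, that $M_{\mathcal{X}}(0)$ has a repeated unit eigenvalue of geometric multiplicity $1$, and that $\delta_L(0)=\delta_R(0)=1$. Define $\alpha,\beta\in\mathbb{R}$ by $$\det(M_{\mathcal{X}}(\varepsilon))=1+\alpha\varepsilon+\mathcal{O}(\varepsilon^2),\qquad \mathrm{trace}(M_{\mathcal{X}}(\varepsilon))=2+\beta\varepsilon+\mathcal{O}(\varepsilon^2),$$ and suppose $\alpha\ne0$ and $\alpha\ne\beta$. Then the following statements are equivalent: i) $\beta<\alpha<0$; ii) there exists $\varepsilon^*>0$ such that for all $0<\varepsilon\le\varepsilon^*$ the eigenvalues of $M_{\mathcal{X}}(\varepsilon)$ are complex-valued (non-real) and have modulus less than $1$; iii) there exist $k_{\rm min}\in\mathbb{Z}$ and $\Delta>0$ such that for all $k\ge k_{\rm min}$ and $0<\varepsilon\le\Delta k^{-2}$, the eigenvalues of $M_{\mathcal{S}[k]}(\varepsilon)$ have modulus less than $1$. Furthermore, with $\beta<\alpha<0$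 the eigenvalues of $M_{\mathcal{X}}(\varepsilon)$ are $\lambda(\varepsilon)=r(\varepsilon)e^{\pm{\rm i}\theta(\varepsilon)}$, where $$r(\varepsilon)=1+\frac{\alpha}{2}\varepsilon+\mathcal{O}(\varepsilon^2),\qquad \theta(\varepsilon)=\sqrt{\alpha-\beta}\,\varepsilon^{\frac12}+\mathcal{O}(\varepsilon).$$
   Context: For real $\tau_L,\delta_L,\tau_R,\delta_R,\mu$ set $A_J=\begin{bmatrix}\tau_J&1\\ -\delta_J&0\end{bmatrix}$ and $f^J(x,y)=A_J\begin{bmatrix}x\\ y\end{bmatrix}+\begin{bmatrix}\mu\\ 0\end{bmatrix}$ for $J\in\{L,R\}$. The border-collision normal form is the continuous map of $\mathbb{R}^2$ equal to $f^L$ for $x\le0$ and $f^R$ for $x\ge0$; the switching manifold is $x=0$. A word $\mathcal{S}=\mathcal{S}_0\cdots\mathcal{S}_{n-1}$ on $\{L,R\}$ is primitive if it is not a power of a shorter word; primitive words are identified with periodic symbol sequences of minimal period $n$. $\mathcal{X}^k\mathcal{Y}$ denotes concatenation of $k$ copies of $\mathcal{X}$ followed by $\mathcal{Y}$. Put $f^{\mathcal{S}}=f^{\mathcal{S}_{n-1}}\circ\cdots\circ f^{\mathcal{S}_0}$, an affine map with matrix part $M_{\mathcal{S}}=A_{\mathcal{S}_{n-1}}\cdots A_{\mathcal{S}_0}$. An $\mathcal{S}$-cycle consists of points $(x_i^{\mathcal{S}},y_i^{\mathcal{S}})$, $i=0,\dots,n-1$, with $(x_0^{\mathcal{S}},y_0^{\mathcal{S}})$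 a fixed point of $f^{\mathcal{S}}$ and $(x_{i+1}^{\mathcal{S}},y_{i+1}^{\mathcal{S}})=f^{\mathcal{S}_i}(x_i^{\mathcal{S}},y_i^{\mathcal{S}})$. It is unique if and only if $1$ is not an eigenvalue of $M_{\mathcal{S}}$. It is admissible if $x_i^{\mathcal{S}}\le0$ whenever $\mathcal{S}_i=L$ and $x_i^{\mathcal{S}}\ge0$ whenever $\mathcal{S}_i=R$. It has no points on the switching manifold if $x_i^{\mathcal{S}}\neq0$ for all $i$. An admissible $\mathcal{S}$-cycle with no points on the switching manifold is stable if both eigenvalues of $M_{\mathcal{S}}$ have modulus $\le1$. When the parameters depend on $\varepsilon$, so do all these objects. *)

(* Defs.v *)
From HB Require Import structures.
From mathcomp Require Import all_boot all_order all_algebra.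
From mathcomp Require Import all_classical all_reals all_analysis.
From mathcomp Require Import complex.

Set Implicit Arguments.
Unset Strict Implicit.
Unset Printing Implicit Defensive.

Import Order.TTheory GRing.Theory Num.Theory.
Import numFieldNormedType.Exports.

Local Open Scope classical_set_scope.
Local Open Scope ring_scope.
Local Open Scope complex_scope.

Inductive symbol := SymL | SymR.

Definition word := seq symbol.

Definition primitive (W : word) : Prop :=
  forall (V : word) (m : nat), (size V < size W)%N -> W <> flatten (nseq m V).

(* The word X^k Y. *)
Definition word_pow_cat (X Y : word) (k : nat) : word :=
  flatten (nseq k X) ++ Y.

Section BorderCollisionNormalForm.

(* [tau SymL], [tau SymR] are tau_L, tau_R, and likewise for [delta]. *)
Variables (R : realType) (tau delta : symbol -> R) (mu : R).

Definition piece_mx (J : symbol) : 'M[R]_2 :=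
  \matrix_(i < 2, j < 2)
    if i == 0 then (if j == 0 then tau J else 1)
    else (if j == 0 then - delta J else 0).

Definition piece_map (J : symbol) (p : 'cV[R]_2) : 'cV[R]_2 :=
  piece_mx J *m p + \col_(i < 2) (if i == 0 then mu else 0).

(* [foldl] makes the first symbol of the word act first: [word_map W] is
   f^{W_{n-1}} o ... o f^{W_0} and [word_mx W] is A_{W_{n-1}} ... A_{W_0}. *)
Definition word_map (W : word) (p : 'cV[R]_2) : 'cV[R]_2 :=
  foldl (fun q J => piece_map J q) p W.

Definition word_mx (W : word) : 'M[R]_2 :=
  foldl (fun B J => piece_mx J *m B) 1%:M W.

(* The default value [SymL] of [nth] is never reached, here and below. *)
Definition is_cycle (W : word) (p : seq 'cV[R]_2) : Prop :=
  [/\ size p = size W,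
      word_map W p`_0 = p`_0 &
      forall i : nat, (i.+1 < size W)%N ->
        p`_i.+1 = piece_map (nth SymL W i) p`_i].

Definition xcoord (p : 'cV[R]_2) : R := p 0 0.

Definition admissible (W : word) (p : seq 'cV[R]_2) : Prop :=
  forall i : nat, (i < size W)%N ->
    match nth SymL W i with
    | SymL => xcoord p`_i <= 0
    | SymR => 0 <= xcoord p`_i
    end.

Definition off_switching_manifold (W : word) (p : seq 'cV[R]_2) : Prop :=
  forall i : nat, (i < size W)%N -> xcoord p`_i != 0.

(* [eigenvalue] is about left eigenvectors, which give the same eigenvalues. *)
Definition complex_eigenvalue (B : 'M[R]_2) (z : R[i]) : bool :=
  eigenvalue (map_mx (real_complex R) B) z.

(* Stability depends on the cycle only through its word. *)
Definition stable (W : word) : Prop :=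
  forall z : R[i], complex_eigenvalue (word_mx W) z -> `|z| <= 1.

Definition has_unique_admissible_stable_cycle (W : word) : Prop :=
  exists p : seq 'cV[R]_2,
    [/\ Logic.unique (is_cycle W) p,
        admissible W p,
        off_switching_manifold W p &
        stable W].

(* 1 has algebraic multiplicity 2 and geometric multiplicity 1. *)
Definition repeated_unit_eigenvalue_geom1 (B : 'M[R]_2) : Prop :=
  mup 1 (char_poly B) = 2%N /\ \rank (eigenspace B 1) = 1%N.

End BorderCollisionNormalForm.

(* C^oo on a neighbourhood of 0. *)
Definition smooth_near0 (R : realType) (g : R -> R) : Prop :=
  \forall e \near (0 : R), forall n : nat, derivable (derive1n n g) e 1.

(* e^{i t}, by Euler's formula. *)
Definition expi (R : realType) (t : R) : R[i] := cos t +i* sin t.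

(* Main.v *)
(* Write A = M_X, B = M_Y, so that M_{S[k]} = B A^k. At e = 0 all determinants are
   1 and A = 1 + N with N^2 = 0, N <> 0, hence tr (B A^k) = tr B + k tr (B N).
   Stability for infinitely many k forces tr (B N) = 0, which makes the line
   spanned by the range of N an eigenline of B; so B has real eigenvalues
   b, 1/b, and stability together with uniqueness leaves only tr B = -2.
   Hence every S[k]-cycle has trace -2 at e = 0, on the boundary of Jury's
   stability region, and stability for e > 0 is decided by the signs of
   1 + tr + det and of det - 1.
   By Cayley-Hamilton h_k = tr (B A^k) satisfies h_{k+2} = t h_{k+1} - d h_k with
   t = tr A, d = det A; as long as e k^2 is small this gives
   h_k + 2 ~ (alpha - beta) e k^2 up to errors O(e k), while
   det (B A^k) - 1 ~ alpha e k up to O(e).  So for large k stability amounts to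
   alpha > beta and alpha < 0, which is also what the discriminant
   t^2 - 4 d ~ 4 (beta - alpha) e and the determinant d say about A itself. *)

Require Import Defs.
From HB Require Import structures.
From mathcomp Require Import all_boot all_order all_algebra.
From mathcomp Require Import all_classical all_reals all_analysis.
From mathcomp Require Import complex.
From mathcomp Require Import ring lra.

Set Implicit Arguments.
Unset Strict Implicit.
Unset Printing Implicit Defensive.

Import Order.TTheory GRing.Theory Num.Theory.
Import numFieldNormedType.Exports.

Local Open Scope classical_set_scope.
Local Open Scope ring_scope.
Local Open Scope complex_scope.

(** * Two-by-two matrices and their characteristic equation *)

Lemma trace_mx2 (F : pzRingType) (B : 'M[F]_2) : \tr B = B 0 0 + B 1 1.
Proof.
by rewrite /mxtrace !big_ord_recl big_ord0 addr0; congr (_ + B _ _); apply/val_inj.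
Qed.

Lemma det_mx2 (F : comPzRingType) (B : 'M[F]_2) :
  \det B = B 0 0 * B 1 1 - B 0 1 * B 1 0.
Proof.
have e1 : lift ord0 ord0 = 1 :> 'I_2 by apply/val_inj.
have e2 : lift 1 ord0 = 0 :> 'I_2 by apply/val_inj.
rewrite (expand_det_row _ 0) !big_ord_recl big_ord0 /cofactor !det_mx11 !mxE.
rewrite !e1 !e2 /= /bump /= !(addn0, add0n) expr0 expr1; ring.
Qed.

Lemma mulmx2E (F : pzRingType) (A B : 'M[F]_2) i j :
  (A *m B) i j = A i 0 * B 0 j + A i 1 * B 1 j.
Proof.
rewrite !mxE !big_ord_recl big_ord0 addr0.
by congr (_ + A _ _ * B _ _); apply/val_inj.
Qed.

Lemma matrix2P (F : Type) (A B : 'M[F]_2) :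
  A 0 0 = B 0 0 -> A 0 1 = B 0 1 -> A 1 0 = B 1 0 -> A 1 1 = B 1 1 -> A = B.
Proof.
move=> h00 h01 h10 h11; have I2 (i : 'I_2) : i = 0 \/ i = 1.
  by case: i => [[|[|//]] hi]; [left | right]; apply/val_inj.
by apply/matrixP => i j; case: (I2 i) => ->; case: (I2 j) => ->.
Qed.

Lemma mulmx2_Cayley_Hamilton (F : comPzRingType) (A : 'M[F]_2) :
  A *m A = \tr A *: A - (\det A)%:M.
Proof.
apply: matrix2P; rewrite mulmx2E !mxE trace_mx2 det_mx2 /= ?mulr1n ?mulr0n; ring.
Qed.

Lemma eigenvalue_mx2 (F : fieldType) (B : 'M[F]_2) (z : F) :
  eigenvalue B z = (z ^+ 2 - \tr B * z + \det B == 0).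
Proof.
rewrite eigenvalue_root_char /root /char_poly det_mx2 !mxE /= ?mulr1n ?mulr0n.
rewrite !hornerE trace_mx2 det_mx2; congr (_ == 0); ring.
Qed.

Lemma complex_eigenvalueE (R : realType) (B : 'M[R]_2) (z : R[i]) :
  complex_eigenvalue B z = (z ^+ 2 - (\tr B)%:C * z + (\det B)%:C == 0).
Proof. by rewrite /complex_eigenvalue eigenvalue_mx2 trace_map_mx det_map_mx. Qed.

(** The imaginary part of the characteristic equation factors, so that an eigenvalue is real or has
    real part [\tr B / 2]. *)
Lemma complex_eigenvalue_ReIm (R : realType) (B : 'M[R]_2) (a b : R) :
  complex_eigenvalue B (a +i* b) <->
  a ^+ 2 - b ^+ 2 - \tr B * a + \det B = 0 /\ b * (2 * a - \tr B) = 0.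
Proof.
rewrite complex_eigenvalueE expr2; set t := \tr B; set d := \det B.
have -> : (a +i* b) * (a +i* b) - t%:C * (a +i* b) + d%:C =
  (a ^+ 2 - b ^+ 2 - t * a + d) +i* (b * (2 * a - t)).
  by apply/eqP; rewrite eq_complex /=; apply/andP; split; apply/eqP; ring.
by rewrite eq_complex /=; split=> [/andP[/eqP -> /eqP ->]|[-> ->]] //; rewrite eqxx.
Qed.

(** * Moduli of eigenvalues and Jury's conditions *)

Lemma normc_lt1 (R : realType) (a b : R) :
  (`|a +i* b| < 1) = (a ^+ 2 + b ^+ 2 < 1).
Proof.
rewrite normc_def -[1](rmorph1 (real_complex R)) /= ltcR -[X in _ < X]sqrtr1.
by rewrite ltr_sqrt.
Qed.

Lemma normc_le1 (R : realType) (a b : R) :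
  (`|a +i* b| <= 1) = (a ^+ 2 + b ^+ 2 <= 1).
Proof.
rewrite normc_def -[1](rmorph1 (real_complex R)) /= lecR -[X in _ <= X]sqrtr1.
by rewrite ler_sqrt.
Qed.

(** [s] is the sign in the quadratic formula, so that both roots are covered at once. *)
Lemma real_eigenvalue (R : realType) (B : 'M[R]_2) (s : R) :
  4 * \det B <= \tr B ^+ 2 -> s ^+ 2 = 1 ->
  complex_eigenvalue B (((\tr B + s * Num.sqrt (\tr B ^+ 2 - 4 * \det B)) / 2)%:C).
Proof.
move=> h hs; apply/complex_eigenvalue_ReIm; split; last by rewrite mul0r.
have := @sqr_sqrtr R (\tr B ^+ 2 - 4 * \det B); rewrite subr_ge0 => /(_ h).
set q := Num.sqrt _ => hq.
have -> : ((\tr B + s * q) / 2) ^+ 2 - 0 ^+ 2 - \tr B * ((\tr B + s * q) / 2)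
    + \det B = (s ^+ 2 * q ^+ 2 - \tr B ^+ 2 + 4 * \det B) / 4 by field.
by rewrite hs hq; field.
Qed.

(** The characteristic polynomial is positive at 1 and -1, and its vertex lies between them because
    [|\tr B| < 2]; so it has no real root outside (-1, 1). A nonreal root has squared modulus
    [\det B]. *)
Lemma jury_sufficient (R : realType) (B : 'M[R]_2) :
  \det B < 1 -> `|\tr B| < 1 + \det B ->
  forall z, complex_eigenvalue B z -> `|z| < 1.
Proof.
move=> d1 /ltr_normlP[ht1 ht2] [a b] /complex_eigenvalue_ReIm[e1 /eqP].
rewrite normc_lt1 mulf_eq0 => /orP[/eqP b0|/eqP h].
  move: e1; rewrite b0 expr0n /= subr0 addr0 => e1.
  rewrite ltNge; apply/negP => ge1.
  have /orP[a1|a1] : (1 <= a) || (a <= -1).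
    by case: (leP 1 a) => //= ?; nra.
    nra.
  nra.
have -> : a ^+ 2 + b ^+ 2 = \det B by nra.
by [].
Qed.

Section Spectrum.
Variables (R : realType) (B : 'M[R]_2).

(** A bound assumed for all eigenvalues says something only through eigenvalues that exist. The
    quadratic formula supplies them, and their sum and product, or their modulus, carry the bound
    over to trace and determinant. *)
Lemma eigenvalue_pair :
  (exists r1 r2 : R, [/\ r1 + r2 = \tr B, r1 * r2 = \det B,
     complex_eigenvalue B r1%:C & complex_eigenvalue B r2%:C]) \/
  (\tr B ^+ 2 < 4 * \det B /\
     exists a b : R, complex_eigenvalue B (a +i* b) /\ a ^+ 2 + b ^+ 2 = \det B).
Proof.
have [h|h] := leP (4 * \det B) (\tr B ^+ 2); [left|right].
  have e1 := real_eigenvalue h (expr1n R 2).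
  have sN1 : (-1) ^+ 2 = 1 :> R by ring.
  have e2 := real_eigenvalue h sN1.
  eexists; eexists; split; [| |exact: e1|exact: e2].
    by field.
  have := @sqr_sqrtr R (\tr B ^+ 2 - 4 * \det B); rewrite subr_ge0 => /(_ h).
  set q := Num.sqrt _ => hq.
  have -> : (\tr B + 1 * q) / 2 * ((\tr B + -1 * q) / 2) = (\tr B ^+ 2 - q ^+ 2) / 4.
    by field.
  by rewrite hq; field.
split=> //; have := @sqr_sqrtr R (4 * \det B - \tr B ^+ 2).
rewrite subr_ge0 (ltW h) => /(_ isT); set q := Num.sqrt _ => hq.
exists (\tr B / 2), (q / 2); split.
  apply/complex_eigenvalue_ReIm; split; last by field.
  have -> : (\tr B / 2) ^+ 2 - (q / 2) ^+ 2 - \tr B * (\tr B / 2) + \det B =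
    (4 * \det B - \tr B ^+ 2 - q ^+ 2) / 4 by field.
  by rewrite hq subrr mul0r.
have -> : (\tr B / 2) ^+ 2 + (q / 2) ^+ 2 = (\tr B ^+ 2 + q ^+ 2) / 4 by field.
by rewrite hq; field.
Qed.

Lemma normc_real_lt1 (a : R) : (`|a%:C| < 1) = (-1 < a < 1).
Proof.
rewrite normc_lt1 expr0n addr0; apply/idP/idP => [h|/andP[? ?]]; last by nra.
by apply/andP; split; nra.
Qed.

Lemma normc_real_le1 (a : R) : (`|a%:C| <= 1) = (-1 <= a <= 1).
Proof.
rewrite normc_le1 expr0n addr0; apply/idP/idP => [h|/andP[? ?]]; last by nra.
by apply/andP; split; nra.
Qed.

(** For real eigenvalues [1 + \tr B + \det B] is [(1 + r1) * (1 + r2)]; for nonreal ones it exceeds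
    [(1 + \tr B / 2) ^+ 2]. *)
Lemma jury_necessary :
  (forall z, complex_eigenvalue B z -> `|z| < 1) ->
  \det B < 1 /\ 0 < 1 + \tr B + \det B.
Proof.
move=> h; case: eigenvalue_pair => [[r1 [r2 [<- <- /h + /h]]]|[disc [a [b [/h + hd]]]]].
  rewrite !normc_real_lt1 => /andP[? ?] /andP[? ?].
  split; nra.
rewrite normc_lt1 hd => ?; split=> //.
have := sqr_ge0 (1 + \tr B / 2); nra.
Qed.

(** Real eigenvalues in [-1, 1] with product 1 are both 1 or both -1; nonreal ones give
    [\tr B ^+ 2 < 4]. *)
Lemma stable_trace : \det B = 1 ->
  (forall z, complex_eigenvalue B z -> `|z| <= 1) -> -2 <= \tr B <= 2.
Proof.
move=> d1 h; case: eigenvalue_pair => [[r1 [r2 [<- e /h + /h]]]|[disc _]].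
  rewrite !normc_real_le1 => /andP[? ?] /andP[? ?].
  by rewrite d1 in e; apply/andP; split; nra.
by rewrite d1 in disc; apply/andP; split; nra.
Qed.

(** Nonreal eigenvalues are conjugate with product [\det B], so statement ii) splits into a sign
    condition on the discriminant and one on the determinant. *)
Lemma nonreal_stableP :
  (forall z, complex_eigenvalue B z -> complex.Im z != 0 /\ `|z| < 1) <->
  \tr B ^+ 2 < 4 * \det B /\ \det B < 1.
Proof.
split=> [h|[disc d1]].
  case: eigenvalue_pair => [[r1 [r2 [_ _ /h[]]]]|[disc [a [b [/h + hd]]]]].
    by rewrite eqxx.
  by rewrite normc_lt1 hd => -[].
move=> [a b] /complex_eigenvalue_ReIm /= [e1 e2].
have b0 : b != 0.
  apply/eqP => b0; rewrite b0 expr0n subr0 in e1.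
  have := sqr_ge0 (2 * a - \tr B); nra.
have e3 : 2 * a = \tr B.
  by apply/eqP; rewrite -subr_eq0; move/eqP: e2; rewrite mulf_eq0 (negPf b0).
by split=> //; rewrite normc_lt1; have -> : a ^+ 2 + b ^+ 2 = \det B by nra.
Qed.

End Spectrum.

(** * Matrices of words, and uniqueness of cycles *)

Section Words.
Variables (R : realType) (tau delta : symbol -> R) (mu : R).
Local Notation Mx := (word_mx tau delta).
Local Notation Map := (word_map tau delta mu).

Lemma word_mx_rcons W J : Mx (rcons W J) = piece_mx tau delta J *m Mx W.
Proof. by rewrite /word_mx foldl_rcons. Qed.

Lemma word_map_rcons W J p : Map (rcons W J) p = piece_map tau delta mu J (Map W p).
Proof. by rewrite /word_map foldl_rcons. Qed.

Lemma word_mx_cat U V : Mx (U ++ V) = Mx V *m Mx U.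
Proof.
elim/last_ind: V => [|V J IH]; first by rewrite cats0 mul1mx.
by rewrite -rcons_cat !word_mx_rcons IH mulmxA.
Qed.

Lemma word_mx_pow_cat U V k : Mx (word_pow_cat U V k) = Mx V *m Mx U ^+ k.
Proof.
rewrite word_mx_cat; congr (_ *m _); elim: k => [|k IH] //=.
by rewrite word_mx_cat IH exprSr.
Qed.

Lemma word_map_affine W p v : Map W (p + v) = Map W p + Mx W *m v.
Proof.
elim/last_ind: W => [|W J IH]; first by rewrite mul1mx.
by rewrite !word_map_rcons word_mx_rcons IH /piece_map mulmxDr mulmxA addrAC.
Qed.

Lemma det_piece_mx J : \det (piece_mx tau delta J) = delta J.
Proof. by rewrite det_mx2 !mxE /=; ring. Qed.

Lemma det_word_mx_eq1 W : (forall J, delta J = 1) -> \det (Mx W) = 1.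
Proof.
move=> d1; elim/last_ind: W => [|W J IH]; first exact: det1.
by rewrite word_mx_rcons det_mulmx IH det_piece_mx d1 mulr1.
Qed.

(** If 1 were an eigenvalue, moving the initial point along a fixed vector of the matrix would give
    the start of a second cycle. *)
Lemma unique_cycle_det W p : W <> [::] ->
  Logic.unique (is_cycle tau delta mu W) p -> 1 - \tr (Mx W) + \det (Mx W) != 0.
Proof.
move=> W0 [[sp fp _] up]; apply/negP => h.
have sW : (0 < size W)%N by case: (W) W0.
(* [eigenvalue] yields row vectors; passing to the transpose gives a column [v^T] fixed by
   [Mx W]. *)
have : eigenvalue (Mx W)^T 1 by rewrite eigenvalue_mx2 mxtrace_tr det_tr expr1n mulr1.
case/eigenvalueP => v; rewrite scale1r => /(congr1 trmx).
rewrite trmx_mul trmxK => hv v0.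
pose q i := Map (take i W) (p`_0 + v^T).
have cq : is_cycle tau delta mu W (mkseq q (size W)).
  split; first by rewrite size_mkseq.
    by rewrite nth_mkseq // /q take0 /= word_map_affine fp hv.
  move=> i hi; rewrite !nth_mkseq //; last exact: ltnW.
  by rewrite /q (take_nth SymL) ?word_map_rcons // ltnW.
have /(congr1 (fun s => s`_0)) := up _ cq; rewrite nth_mkseq // /q take0 /=.
move=> /esym/eqP; rewrite -subr_eq0 addrAC subrr add0r => /eqP/(congr1 trmx).
by rewrite trmxK trmx0 => /eqP; rewrite (negPf v0).
Qed.

End Words.

(** * Traces along the powers of a unipotent matrix *)

Lemma infinite_nat_unbounded (A : set nat) (n : nat) :
  infinite_set A -> exists2 k, A k & (n <= k)%N.
Proof.
move=> iA; apply: contrapT => h; apply: iA.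
apply: (@sub_finite_set _ _ `I_n); last exact: finite_II.
by move=> k Ak /=; rewrite ltnNge; apply/negP => nk; apply: h; exists k.
Qed.

Lemma trace_mul_pow_rec (F : comNzRingType) (A B : 'M[F]_2) k :
  \tr (B *m A ^+ k.+2) =
  \tr A * \tr (B *m A ^+ k.+1) - \det A * \tr (B *m A ^+ k).
Proof.
have -> : A ^+ k.+2 = A *m A *m A ^+ k by rewrite !exprS mulrA.
rewrite mulmx2_Cayley_Hamilton mulmxBl -scalemxAl mul_scalar_mx -[A *m _]exprS.
by rewrite mulmxBr -!scalemxAr raddfB /= !mxtraceZ.
Qed.

(* Boundedness of [tr B + k tr (B N)], [N = A - 1], forces [tr (B N) = 0]; since
   [N] has rank one and square zero, the line [N] spans is then an eigenline of
   [B], so that [B] has real eigenvalues [c] and [1 / c]. *)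
Lemma unipotent_trace_bounded (R : realType) (A B : 'M[R]_2) :
  \det A = 1 -> \tr A = 2 -> A != 1 -> \det B = 1 ->
  infinite_set [set k | -2 <= \tr (B *m A ^+ k) < 2] ->
  \tr B = -2 /\ \tr (B *m A) = -2.
Proof.
move=> dA tA A1 dB infk.
(* With [N = A - 1] this is the trace of [B *m N]. As [A] has trace 2 and determinant 1, the
   recurrence makes the traces an arithmetic progression with step [m]. *)
pose m := \tr (B *m A) - \tr B.
have hk k : \tr (B *m A ^+ k) = \tr B + k%:R * m /\
    \tr (B *m A ^+ k.+1) = \tr B + k.+1%:R * m.
  elim: k => [|k [IH1 IH2]].
    by rewrite expr0 expr1 mulmx1 mul0r addr0 mul1r /m; split=> //; ring.
  split=> //; rewrite trace_mul_pow_rec dA tA IH1 IH2 -[in RHS]natr1 -natr1; ring.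
have m0 : m = 0.
  apply/eqP/contraT => m0; have m_gt0 : 0 < `|m| by rewrite normr_gt0.
  (* Beyond index [K] a progression with nonzero step has left [-2, 2] for good. *)
  pose K := (2 + `|\tr B|) / `|m|.
  have K0 : 0 <= K by apply: divr_ge0; rewrite ?addr_ge0.
  have [k /= /andP[k1 k2] Kk] := infinite_nat_unbounded (Num.bound K) infk.
  have : K < k%:R by rewrite (lt_le_trans (archi_boundP K0)) // ler_nat.
  rewrite /K ltr_pdivrMr // => h.
  have e : k%:R * m = \tr (B *m A ^+ k) - \tr B by rewrite (hk k).1; ring.
  have : k%:R * `|m| <= `|\tr (B *m A ^+ k)| + `|\tr B|.
    by rewrite -[X in X * _]ger0_norm // -normrM e ler_normB.
  have : `|\tr (B *m A ^+ k)| <= 2 by rewrite ler_norml k1 ltW.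
  lra.
have [k /= + _] := infinite_nat_unbounded 0 infk.
rewrite (hk k).1 m0 mulr0 addr0 => /andP[b1 b2].
have tBA : \tr (B *m A) = \tr B by apply/eqP; rewrite -subr_eq0 -/m m0.
suff : 4 <= \tr B ^+ 2 by move=> ?; split; nra.
move: tBA dA tA dB; rewrite !trace_mx2 !det_mx2 !mulmx2E.
have : ~ (A 0 1 = 0 /\ A 1 0 = 0 /\ A 0 0 = 1 /\ A 1 1 = 1).
  move=> [h01 [h10 [h00 h11]]]; move/eqP: A1; apply.
  by apply: matrix2P; rewrite ?h01 ?h10 ?h00 ?h11 !mxE.
move: (A 0 0) (A 0 1) (A 1 0) (A 1 1) (B 0 0) (B 0 1) (B 1 0) (B 1 1).
move=> a b c d p q r s hA e1 e2 e3 e4.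
have ed : d = 2 - a by lra.
(* If [b = 0] then [a = 1] and [c] is nonzero, so [q = 0]: [B] is triangular with diagonal entries
   [p] and [s] of product 1. *)
have [b0|b0] := eqVneq b 0.
  have [c0|c0] := eqVneq c 0.
    by case: hA; rewrite b0 c0; do !split => //; subst; nra.
  have c2 : 0 < c ^+ 2 by rewrite exprn_even_gt0.
  have a1 : a = 1 by subst; nra.
  have q0 : q = 0 by apply: (mulIf c0); subst; nra.
  subst; have := sqr_ge0 (p - s); nra.
have b2' : 0 < b ^+ 2 by rewrite exprn_even_gt0.
have e5 : (a - 1) ^+ 2 + b * c = 0 by subst; nra.
have e6 : (a - 1) * (p - s) + b * r + c * q = 0 by subst; nra.
have e7 : p * s - q * r - 1 = 0 by lra.
(* The range of [N] is spanned by the vector (b, 1 - a), on which [B] has eigenvalue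
   [p - (a - 1) * q / b]. The first square below is [b ^+ 2] times the squared difference of the two
   eigenvalues of [B]; the other terms are multiples of the three relations. *)
rewrite -subr_ge0 -(pmulr_rge0 _ b2').
have -> : b ^+ 2 * ((p + s) ^+ 2 - 4) =
    (b * (p - s) - 2 * (a - 1) * q) ^+ 2 + 4 * b ^+ 2 * (p * s - q * r - 1)
    + 4 * b * q * ((a - 1) * (p - s) + b * r + c * q)
    - 4 * q ^+ 2 * ((a - 1) ^+ 2 + b * c) by ring.
by rewrite e5 e6 e7 !mulr0 subr0 !addr0 sqr_ge0.
Qed.

(** * Growth of trace and determinant along the powers of a nearly unipotent matrix *)

(* The increments [h (k+1) - h k] grow by [(1 + d - t) * 2 + O(e^2 k)] at each
   step, so that [h k + 2] follows a parabola of sign [s]. *)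
Lemma perturbed_recurrence_bounds (R : realType) (h : nat -> R)
    (t d C c e s : R) (K k : nat) :
  (forall i, h i.+2 = t * h i.+1 - d * h i) ->
  0 < e -> 0 < c -> 0 < C ->
  `|h 0%N + 2| <= C * e -> `|h 1%N - h 0%N| <= C * e ->
  `|d - 1| <= C * e -> `|t - 1 - d| <= C * e ->
  s ^+ 2 = 1 -> c * e <= s * (1 + d - t) ->
  16 * C * e * K%:R ^+ 2 <= 1 -> 16 * C ^+ 2 * e * K%:R <= c ->
  (k <= K)%N ->
  [/\ `|h k.+1 - h k| <= 4 * C * e * k.+1%:R,
      `|h k + 2| <= 4 * C * e * k.+1%:R ^+ 2,
      - (C * e) + k%:R * (c * e / 2) <= s * (h k.+1 - h k) &
      - (C * e * k.+1%:R) + c / 4 * e * k%:R * (k%:R - 1) <= s * (h k + 2)].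
Proof.
move=> h_rec e_gt0 c_gt0 C_gt0 h0 h1 d1 g_ub s1 g_lb eK1 eK2.
have s_norm : `|s| = 1 by apply/eqP; rewrite -sqr_norm_eq1 s1.
have sM (x : R) : `|s * x| = `|x| by rewrite normrM s_norm mul1r.
have sub (x y : R) : `|x| <= y -> - y <= s * x.
  by rewrite -(sM x) => /ler_normlP[? _]; lra.
elim: k => [_|k IH kK].
  have Ce : 0 < C * e by exact: mulr_gt0.
  split; rewrite ?mulr1 ?mul0r ?mulr0 ?mul0r ?addr0 ?expr1n ?mulr1.
  - by apply: le_trans h1 _; lra.
  - by apply: le_trans h0 _; lra.
  - exact: sub.
  - exact: sub.
have [w1 w2 w3 w4] := IH (ltnW kK); clear IH.
have k0 : 0 <= k%:R :> R by [].
have kK' : k%:R + 1 <= K%:R :> R by rewrite natr1 ler_nat.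
move: w1 w2 w3 w4; rewrite -(natr1 k.+1) -(natr1 k).
set x := k%:R in k0 kK' *.
set w := h k.+1 - h k => w1 w2 w3 w4.
have Ce : 0 < C * e by exact: mulr_gt0.
have hS : h k.+1 = h k + w by rewrite /w; ring.
(* The drive [t - 1 - d] acts through [h k.+1], which stays near -2, while [d - 1] multiplies the
   small increment [w] and is of second order. *)
have wS : h k.+2 - h k.+1 = w + (t - 1 - d) * h k.+1 + (d - 1) * w.
  by rewrite h_rec /w; ring.
clear h_rec h0 h1 s1.
have f1 : C * e * (x + 1) <= C * e * K%:R by rewrite ler_pM2l.
have f2 : C * e * K%:R <= C * e * K%:R ^+ 2.
  by rewrite ler_pM2l // expr2 ler_peMr; lra.
have f3 : C * e * (x + 1 + 1) ^+ 2 <= C * e * (4 * K%:R ^+ 2).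
  by rewrite ler_pM2l //; nra.
have w1' : `|w| <= 1.
  apply: le_trans w1 _; lra.
have hS1 : `|h k.+1 + 2| <= 4 * C * e * (x + 1 + 1) ^+ 2.
  have -> : h k.+1 + 2 = (h k + 2) + w by rewrite hS; ring.
  have hn : `|h k + 2 + w| <= `|h k + 2| + `|w| := ler_normD _ _.
  have f0 : 0 <= C * e * x by rewrite mulr_ge0 // ltW.
  apply: (le_trans hn).
  lra.
have hS2 : `|h k.+1 + 2| <= 1.
  apply: le_trans hS1 _; lra.
have hS3 : -3 <= h k.+1 <= -1.
  by move/ler_normlP: hS2 => [? ?]; apply/andP; split; lra.
have dw : `|(d - 1) * w| <= C * e * (4 * C * e * (x + 1)).
  by rewrite normrM ler_pM.
have dw' : `|(d - 1) * w| <= C * e * 1.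
  by rewrite normrM ler_pM.
split => //.
(* A step adds at most [3 * (C * e)] from the drive, as [|h k.+1| <= 3], and [C * e] from the other
   term, as [|w| <= 1]; hence the constant 4. *)
- rewrite wS; apply: le_trans (ler_normD _ _) _; apply: le_trans (lerD (ler_normD _ _) dw') _.
  have : `|(t - 1 - d) * h k.+1| <= C * e * 3.
    by rewrite normrM ler_pM // ler_norml; case/andP: hS3 => ? ?; apply/andP; split; lra.
  lra.
- have -> : s * (h k.+2 - h k.+1) = s * w + s * (1 + d - t) * - h k.+1 + s * ((d - 1) * w).
    by rewrite wS; ring.
  have g1 : c * e <= s * (1 + d - t) * - h k.+1.
    by rewrite -[c * e]mulr1 ler_pM // ?mulr_ge0 ?(ltW e_gt0) ?(ltW c_gt0) //; lra.
  (* By [eK2] the second-order term costs at most half of the drive [c * e], and the other half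
     remains as growth. *)
  have g2 : C * e * (4 * C * e * (x + 1)) <= c * e / 2.
    have -> : C * e * (4 * C * e * (x + 1)) = (4 * C ^+ 2 * e * (x + 1)) * e by ring.
    have : 4 * C ^+ 2 * e * (x + 1) <= 4 * C ^+ 2 * e * K%:R.
      by rewrite ler_pM2l //; rewrite !mulr_gt0 // exprn_gt0.
    move=> le1; have le2 : 4 * C ^+ 2 * e * (x + 1) <= c / 2 by lra.
    by have := ler_wpM2r (ltW e_gt0) le2; lra.
  have := sub _ _ dw; lra.
(* Summing the increments' lower bounds [i * (c * e / 2)] over i < k gives the quadratic term
   [c / 4 * e * k * (k - 1)]. *)
- have -> : s * (h k.+1 + 2) = s * (h k + 2) + s * w by rewrite hS; ring.
  lra.
Qed.


(** Meant for the determinant of [B *m A ^+ k]. While the product stays between 1/2 and 2, each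
    further factor [d] moves it by at most [2 * C * e], and by at least [c * e / 2] in the direction
    [s]. *)
Lemma geometric_bounds (R : realType) (d0 d C c e s : R) (K k : nat) :
  0 < e -> 0 < c -> 0 < C -> `|d0 - 1| <= C * e -> `|d - 1| <= C * e ->
  s ^+ 2 = 1 -> c * e <= s * (d - 1) -> 8 * C * e * K%:R <= 1 -> (0 < K)%N ->
  (k <= K)%N ->
  `|d0 * d ^+ k - 1| <= 2 * C * e * k.+1%:R /\
  - (C * e) + k%:R * (c * e / 2) <= s * (d0 * d ^+ k - 1).
Proof.
move=> e0 c0 C0 hd0 hd s1 lb eK K0 kK.
have s_norm : `|s| = 1 by apply/eqP; rewrite -sqr_norm_eq1 s1.
have sM (x : R) : `|s * x| = `|x| by rewrite normrM s_norm mul1r.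
have Ce : 0 < C * e by exact: mulr_gt0.
have K1 : 1 <= K%:R :> R by rewrite ler1n.
elim: k kK => [_|k IH kK].
  rewrite expr0 mulr1 mul0r addr0; split; first by nra.
  by rewrite -(sM _) in hd0; move/ler_normlP: hd0 => [? _]; lra.
have {IH} [IH1 IH2] := IH (ltnW kK).
have k0 : 0 <= k%:R :> R by [].
have kK' : k%:R + 1 <= K%:R :> R by rewrite natr1 ler_nat.
move: IH1 IH2.
have -> : d0 * d ^+ k.+1 = d0 * d ^+ k * d by rewrite exprSr mulrA.
rewrite -(natr1 k.+1) -(natr1 k).
set D := d0 * d ^+ k; set x := k%:R in k0 kK' * => IH1 IH2.
have D1 : `|D - 1| <= 2^-1.
  apply: le_trans IH1 _; nra.
have /andP[Dl Du] : 2^-1 <= D <= 2.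
  by move/ler_normlP: D1 => [? ?]; apply/andP; split; lra.
split.
  have -> : D * d - 1 = (D - 1) + D * (d - 1) by ring.
  apply: le_trans (ler_normD _ _) _; rewrite normrM (ger0_norm (_ : 0 <= D)); last by lra.
  have : D * `|d - 1| <= 2 * (C * e) by apply: ler_pM => //; lra.
  lra.
have -> : s * (D * d - 1) = s * (D - 1) + D * (s * (d - 1)) by ring.
have : 2^-1 * (c * e) <= D * (s * (d - 1)).
  by apply: ler_pM; rewrite ?invr_ge0 ?mulr_ge0 ?(ltW c0) ?(ltW e0).
lra.
Qed.

(** * Estimates near zero *)

Section NearZero.
Variable R : realType.

Lemma near0_pos (P : R -> Prop) : (\forall e \near (0 : R), P e) ->
  exists2 eta, 0 < eta & forall e, 0 < e <= eta -> P e.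
Proof.
move=> /nbhs_norm0P [eta /= eta0 h]; exists (eta / 2); first by rewrite divr_gt0.
by move=> e /andP[e0 he]; apply: h; rewrite /= gtr0_norm //; lra.
Qed.

Lemma near_right0 (P : R -> Prop) (eta : R) : 0 < eta ->
  (forall e, 0 < e <= eta -> P e) -> \forall e \near (0 : R)^'+, P e.
Proof.
move=> eta0 h; near=> e; apply: h; apply/andP; split.
  by near: e; exact: nbhs_right_gt.
by near: e; exact: nbhs_right_le.
Unshelve. all: by end_near. Qed.

Lemma eqaddO_near0 (f g h : R -> R) : f = g +O_ (nbhs (0 : R)) h ->
  exists2 C, 0 < C & \forall e \near (0 : R), `|f e - g e| <= C * `|h e|.
Proof. by move=> /eqaddOP/bigO_exP[C [C0 hC]]; exists C. Qed.

Lemma eqaddO_right0 (f g h : R -> R) (C eta : R) : 0 < C -> 0 < eta ->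
  (forall e, 0 < e <= eta -> `|f e - g e| <= C * `|h e|) ->
  f = g +O_ ((0 : R)^'+) h.
Proof.
move=> C0 eta0 hC; apply/eqaddOP/bigO_exP; exists C => //.
exact: near_right0 hC.
Qed.

Lemma derivable_near0_lipschitz (f : R -> R) : derivable f 0 1 ->
  exists2 C, 0 < C & \forall e \near (0 : R), `|f e - f 0| <= C * `|e|.
Proof.
(* The remainder o(e) is taken with constant 1, the first summand of the Lipschitz constant. *)
move=> /derivable_nbhs/eqaddoP/(_ 1 ltr01) h.
exists (1 + `|'D_1 f 0|); first by rewrite ltr_pwDl.
apply: filterS h => e; rewrite !fctE /= addr0 scaler1 mul1r => h.
have -> : f e - f 0 = f e - (f 0 + e *: 'D_1 f 0) + e *: 'D_1 f 0.
  by rewrite opprD addrA subrK.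
apply: le_trans (ler_normD _ _) _; rewrite mulrDl mul1r.
by apply: lerD => //; rewrite normrM mulrC.
Qed.

(** By the mean value theorem the error is [x * (c ^+ 2 / (1 + c ^+ 2))] for some [c] between 0 and
    [x], and the quotient is at most [c]. *)
Lemma atan_bound (x : R) : 0 <= x -> `|atan x - x| <= x ^+ 2.
Proof.
move=> x0.
have [c /itvP c0x] := @MVT_segment R atan (fun x => (1 + x ^+ 2)^-1) 0 x x0
  (fun y _ => is_derive1_atan y) (continuous_subspaceT (@continuous_atan R)).
rewrite atan0 !subr0 => ->.
have c2 : 0 < 1 + c ^+ 2 by rewrite ltr_wpDr ?sqr_ge0.
have c0 : 0 <= c by rewrite c0x.
have cx : c <= x by rewrite c0x.
have -> : (1 + c ^+ 2)^-1 * x - x = - (x * (c ^+ 2 / (1 + c ^+ 2))).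
  by field; rewrite gt_eqF.
have h : c ^+ 2 / (1 + c ^+ 2) <= c by rewrite ler_pdivrMr //; nra.
have h0 : 0 <= c ^+ 2 / (1 + c ^+ 2) by rewrite divr_ge0 ?sqr_ge0 // ltW.
have h1 : 0 <= x * (c ^+ 2 / (1 + c ^+ 2)) by rewrite mulr_ge0.
rewrite normrN (ger0_norm h1).
have -> : x ^+ 2 = x * x by [].
by apply: ler_wpM2l => //; exact: le_trans cx.
Qed.

Lemma derivable_word_mx (tau delta : symbol -> R -> R) (W : word) i j :
  (forall J, derivable (tau J) 0 1) -> (forall J, derivable (delta J) 0 1) ->
  derivable (fun e => word_mx (tau^~ e) (delta^~ e) W i j) 0 1.
Proof.
move=> dt dd; elim/last_ind: W i j => [|W J IH] i j.
  exact: derivable_cst.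
have -> : (fun e => word_mx (tau^~ e) (delta^~ e) (rcons W J) i j) =
    (fun e => piece_mx (tau^~ e) (delta^~ e) J i 0) *
    (fun e => word_mx (tau^~ e) (delta^~ e) W 0 j) +
    (fun e => piece_mx (tau^~ e) (delta^~ e) J i 1) *
    (fun e => word_mx (tau^~ e) (delta^~ e) W 1 j).
  by apply/funext => e; rewrite word_mx_rcons mulmx2E.
have dp i' j' : derivable (fun e => piece_mx (tau^~ e) (delta^~ e) J i' j') 0 1.
  under eq_fun do rewrite mxE.
  case: ifP => _; case: ifP => _.
  - exact: dt.
  - exact: derivable_cst.
  - by apply: derivableN; exact: dd.
  - exact: derivable_cst.
by apply: derivableD; apply: derivableM.
Qed.

End NearZero.

(** * Uniform estimates for the matrices of the words *)

(* [s] and [sd] stand for the signs of [alpha - beta] and [alpha]. *)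
Definition resonant_at (R : realType) (A B : R -> 'M[R]_2) (C c s sd e : R) : Prop :=
  [/\ `|\tr (B e) + 2| <= C * e, `|\tr (B e *m A e) - \tr (B e)| <= C * e,
      `|\det (B e) - 1| <= C * e, `|\det (A e) - 1| <= C * e &
      [/\ `|\tr (A e) - 1 - \det (A e)| <= C * e,
          c * e <= s * (1 + \det (A e) - \tr (A e)) &
          c * e <= sd * (\det (A e) - 1)]].

(** The trace drifts quadratically in [k] and the determinant only linearly, so for large [k] the
    drift of the trace decides the sign of [1 + \tr M + \det M]. The last two bounds keep [M] close
    to trace -2 and determinant 1. *)
Lemma resonant_word_bounds (R : realType) (A B : R -> 'M[R]_2) (C c s sd e : R) (k : nat) :
  0 < C -> 0 < c -> s ^+ 2 = 1 -> sd ^+ 2 = 1 -> 0 < e -> (1 < k)%N ->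
  16 * C * e * k%:R ^+ 2 <= 1 -> 16 * C ^+ 2 * e * k%:R <= c ->
  36 * C < c * k%:R ->
  resonant_at A B C c s sd e ->
  let M := B e *m A e ^+ k in
  [/\ 0 < s * (1 + \tr M + \det M), 0 < sd * (\det M - 1),
      `|\tr M + 2| <= 1 & `|\det M - 1| <= 2^-1].
Proof.
move=> C0 c0 s1 sd1 e0 k2 eK1 eK2 ck [tB tBA dB dA [gA lb1 lb2]] M.
have tr_rec i := trace_mul_pow_rec (A e) (B e) i.
have h1 : `|\tr (B e *m A e ^+ 1) - \tr (B e *m A e ^+ 0)| <= C * e.
  by rewrite expr0 expr1 mulmx1.
have h0 : `|\tr (B e *m A e ^+ 0) + 2| <= C * e by rewrite expr0 mulmx1.
have [_ bT _ lT] :=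
  perturbed_recurrence_bounds tr_rec e0 c0 C0 h0 h1 dA gA s1 lb1 eK1 eK2 (leqnn k).
have k2' : 2 <= k%:R :> R by rewrite ler_nat.
have Ce : 0 < C * e by exact: mulr_gt0.
have f1 : C * e * (2 * k%:R) <= C * e * k%:R ^+ 2 by rewrite ler_pM2l // expr2; nra.
have f2 : C * e * (k%:R + 1) ^+ 2 <= C * e * (4 * k%:R ^+ 2).
  by rewrite ler_pM2l //; nra.
have f3 : 8 * C * e * k%:R <= 1 by lra.
have [bD lD] := geometric_bounds e0 c0 C0 dB dA sd1 lb2 f3 (ltnW k2) (leqnn k).
have dM : \det M = \det (B e) * \det (A e) ^+ k.
  rewrite det_mulmx; congr (_ * _); elim: (k) => [|n IH]; first by rewrite !expr0 det1.
  by rewrite !exprS -IH; exact: det_mulmx.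
move: bT lT bD lD; rewrite -/M -dM -(natr1 k); set x := k%:R in k2' f1 f2 f3 ck eK1 eK2 *.
have s_norm : `|s| = 1 by apply/eqP; rewrite -sqr_norm_eq1 s1.
have sM (y : R) : `|s * y| = `|y| by rewrite normrM s_norm mul1r.
clear h1 h0 tB tBA dB dA gA lb1 lb2 tr_rec dM s1 sd1.
move=> bT lT bD lD; split.
- have -> : s * (1 + \tr M + \det M) = s * (\tr M + 2) + s * (\det M - 1) by ring.
  have : - (2 * C * e * (x + 1)) <= s * (\det M - 1).
    by move: bD; rewrite -sM => /ler_normlP[? _]; lra.
  (* The errors of trace and determinant add up to [3 * C * e * (x + 1)], at most
     [9 * C * e * (x - 1)] since [2 <= x]; the gain has the factor [c / 4], whence 36. *)
  have g : 36 * C * (e * (x - 1)) < c * x * (e * (x - 1)).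
    by rewrite ltr_pM2r // mulr_gt0 //; lra.
  have : 3 * C * e * (x + 1) <= 9 * C * e * (x - 1).
    have -> : 3 * C * e * (x + 1) = C * e * (3 * (x + 1)) by ring.
    have -> : 9 * C * e * (x - 1) = C * e * (9 * (x - 1)) by ring.
    by rewrite ler_pM2l //; lra.
  lra.
- have : 36 * C * e < c * x * e by rewrite ltr_pM2r.
  lra.
- by apply: le_trans bT _; lra.
- have : C * e * (x + 1) <= C * e * (2 * x) by rewrite ler_pM2l //; lra.
  by move=> ?; apply: le_trans bD _; lra.
Qed.

Lemma resonant_word_estimates (R : realType) (A B : R -> 'M[R]_2) (C c eta s sd : R) :
  0 < C -> 0 < c -> 0 < eta -> s ^+ 2 = 1 -> sd ^+ 2 = 1 ->
  (forall e, 0 < e <= eta -> resonant_at A B C c s sd e) ->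
  exists (K : nat) (Delta : R), [/\ (0 < K)%N, 0 < Delta &
    forall (k : nat) (e : R), (K <= k)%N -> 0 < e <= Delta * k%:R ^- 2 ->
    let M := B e *m A e ^+ k in
    [/\ 0 < s * (1 + \tr M + \det M), 0 < sd * (\det M - 1),
        `|\tr M + 2| <= 1 & `|\det M - 1| <= 2^-1]].
Proof.
move=> C0 c0 eta0 s1 sd1 res.
(* From [e * k ^+ 2 <= Delta] follow the same bounds for [e * k] and [e]; the three entries then
   give [e <= eta] and the two smallness conditions of [resonant_word_bounds]. *)
pose Delta := Num.min eta (Num.min (16 * C)^-1 (c / (16 * C ^+ 2))).
have D0 : 0 < Delta by rewrite !lt_min eta0 invr_gt0 divr_gt0 ?mulr_gt0 ?exprn_gt0.
have D1 : Delta <= eta by rewrite ge_min lexx.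
have D2 : 16 * C * Delta <= 1.
  rewrite mulrC -ler_pdivlMr ?mulr_gt0 // div1r.
  by rewrite !ge_min lexx orbT.
have D3 : 16 * C ^+ 2 * Delta <= c.
  rewrite mulrC -ler_pdivlMr ?mulr_gt0 ?exprn_gt0 //.
  by rewrite !ge_min lexx !orbT.
have K0 : 0 <= 36 * C / c by rewrite divr_ge0 ?mulr_ge0 // ltW.
exists (Num.bound (36 * C / c)).+2, Delta; split=> // k e Kk /andP[e0 he].
have k1 : (1 < k)%N by apply: leq_trans Kk.
have k1' : 1 <= k%:R :> R by rewrite ler1n ltnW.
have kk : k%:R <= k%:R ^+ 2 :> R by rewrite expr2; nra.
have k2_gt0 : 0 < k%:R ^+ 2 :> R by lra.
have eD : e * k%:R ^+ 2 <= Delta by rewrite -ler_pdivlMr.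
have eD' : e * k%:R <= Delta by apply: le_trans eD; rewrite ler_pM2l.
apply: (@resonant_word_bounds R A B C c) => //.
- rewrite -mulrA; apply: le_trans D2; rewrite ler_pM2l // mulr_gt0 //.
- rewrite -mulrA; apply: le_trans D3; rewrite ler_pM2l // mulr_gt0 ?exprn_gt0 //.
- rewrite (mulrC c) -ltr_pdivrMr //; apply: lt_le_trans (archi_boundP K0) _.
  by rewrite ler_nat; do 2!apply: ltnW.
- by apply: res; rewrite e0; apply: le_trans D1; apply: le_trans eD'; rewrite ler_peMr // ltW.
Qed.

(** * Resonance at [e = 0] and first-order estimates near it *)

(** Stability puts the traces in [-2, 2], uniqueness excludes 2, and geometric multiplicity 1
    excludes the identity; [unipotent_trace_bounded] then applies. *)
Lemma resonance_traces (R : realType) (mu : R) (tau delta : symbol -> R) (X Y : word) :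
  X <> [::] -> (forall J, delta J = 1) ->
  infinite_set [set k : nat | (1 <= k)%N /\
    has_unique_admissible_stable_cycle tau delta mu (word_pow_cat X Y k)] ->
  repeated_unit_eigenvalue_geom1 (word_mx tau delta X) ->
  \tr (word_mx tau delta Y) = -2 /\
  \tr (word_mx tau delta Y *m word_mx tau delta X) = -2.
Proof.
move=> X0 d1 infk [mup2 rk1].
have detW W : \det (word_mx tau delta W) = 1 by exact: det_word_mx_eq1.
have trX : \tr (word_mx tau delta X) = 2.
  have : eigenvalue (word_mx tau delta X) 1.
    rewrite eigenvalue_root_char; apply/contraT => /mupNroot.
    by rewrite mup2.
  by rewrite eigenvalue_mx2 expr1n mulr1 detW => /eqP; lra.
apply: (unipotent_trace_bounded (detW X) trX _ (detW Y)).
  by apply/eqP => X1; move: rk1; rewrite X1 /eigenspace subrr mxrank_ker mxrank0.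
move=> fin; apply: infk; apply: sub_finite_set fin => k [k1 [p [up _ _ st]]] /=.
have W0 : word_pow_cat X Y k <> [::].
  by case: (k) k1 => // n _; case: (X) X0.
have /andP[l2 u2] := stable_trace (detW _) st.
have := unique_cycle_det W0 up; rewrite detW -word_mx_pow_cat l2 lt_neqAle u2 andbT.
by apply: contraNneq => ->; apply/eqP; ring.
Qed.

(** In [t ^+ 2 - 4 * d = (t - 2) ^+ 2 - 4 * (1 + d - t)] the square is of order [e ^+ 2], and
    [C ^+ 2 * e < c] lets the linear term prevail. *)
Lemma nonreal_disc (R : realType) (t d C c e s : R) : 0 < C -> 0 < e ->
  `|d - 1| <= C * e -> `|t - 1 - d| <= C * e -> C ^+ 2 * e < c ->
  c * e <= s * (1 + d - t) ->
  (s = 1 -> t ^+ 2 < 4 * d) /\ (s = -1 -> 4 * d < t ^+ 2).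
Proof.
move=> C0 e0 /ler_normlP[d1 d2] /ler_normlP[g1 g2] Ce lb.
have disc : t ^+ 2 - 4 * d = (t - 2) ^+ 2 - 4 * (1 + d - t) by ring.
have Ce2 : C ^+ 2 * e * e < c * e by rewrite ltr_pM2r.
have t2 : (t - 2) ^+ 2 <= (2 * (C * e)) ^+ 2.
  have : 0 <= (2 * (C * e) - (t - 2)) * (2 * (C * e) + (t - 2)).
    by rewrite mulr_ge0 //; lra.
  by lra.
have := sqr_ge0 (t - 2).
have e1 : (2 * (C * e)) ^+ 2 = 4 * (C ^+ 2 * e * e) by ring.
rewrite e1 in t2.
split=> se; rewrite se in lb; lra.
Qed.

Lemma resonant_near0 (R : realType) (A B : R -> 'M[R]_2) (alpha beta : R) :
  (forall i j, derivable (fun e => A e i j) 0 1) ->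
  (forall i j, derivable (fun e => B e i j) 0 1) ->
  \tr (B 0) = -2 -> \tr (B 0 *m A 0) = -2 -> \det (B 0) = 1 ->
  (fun e => \det (A e)) = (fun e => 1 + alpha * e) +O_ (nbhs (0 : R)) (fun e => e ^+ 2) ->
  (fun e => \tr (A e)) = (fun e => 2 + beta * e) +O_ (nbhs (0 : R)) (fun e => e ^+ 2) ->
  alpha != 0 -> alpha != beta ->
  exists C c eta : R, [/\ 0 < C, 0 < c, 0 < eta &
    forall e, 0 < e <= eta ->
      resonant_at A B C c (Num.sg (alpha - beta)) (Num.sg alpha) e /\ C ^+ 2 * e < c].
Proof.
move=> dA dB tB0 tBA0 dB0 /eqaddO_near0[C1 C1_gt0 n1] /eqaddO_near0[C2 C2_gt0 n2] a0 ab.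
have dtB : derivable (fun e => \tr (B e)) 0 1.
  have -> : (fun e => \tr (B e)) = (fun e => B e 0 0) + (fun e => B e 1 1).
    by apply/funext => e; rewrite trace_mx2.
  exact: derivableD (dB _ _) (dB _ _).
have dBA i j : derivable (fun e => (B e *m A e) i j) 0 1.
  have -> : (fun e => (B e *m A e) i j) =
      (fun e => B e i 0) * (fun e => A e 0 j) + (fun e => B e i 1) * (fun e => A e 1 j).
    by apply/funext => e; rewrite mulmx2E.
  exact: derivableD (derivableM (dB _ _) (dA _ _)) (derivableM (dB _ _) (dA _ _)).
have dtBA : derivable (fun e => \tr (B e *m A e) - \tr (B e)) 0 1.
  have -> : (fun e => \tr (B e *m A e) - \tr (B e)) =
      (fun e => (B e *m A e) 0 0) + (fun e => (B e *m A e) 1 1) - (fun e => \tr (B e)).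
    by apply/funext => e; rewrite trace_mx2.
  exact: derivableB (derivableD (dBA _ _) (dBA _ _)) dtB.
have ddB : derivable (fun e => \det (B e)) 0 1.
  have -> : (fun e => \det (B e)) =
      (fun e => B e 0 0) * (fun e => B e 1 1) - (fun e => B e 0 1) * (fun e => B e 1 0).
    by apply/funext => e; rewrite det_mx2.
  exact: derivableB (derivableM (dB _ _) (dB _ _)) (derivableM (dB _ _) (dB _ _)).
have [C3 C3_gt0 n3] := derivable_near0_lipschitz dtB.
have [C4 C4_gt0 n4] := derivable_near0_lipschitz dtBA.
have [C5 C5_gt0 n5] := derivable_near0_lipschitz ddB.
have [eta1 eta1_gt0 h1] := near0_pos n1.
have [eta2 eta2_gt0 h2] := near0_pos n2.
have [eta3 eta3_gt0 h3] := near0_pos n3.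
have [eta4 eta4_gt0 h4] := near0_pos n4.
have [eta5 eta5_gt0 h5] := near0_pos n5.
have na : 0 < `|alpha| by rewrite normr_gt0.
have nab : 0 < `|alpha - beta| by rewrite normr_gt0 subr_eq0.
(* Half of each leading coefficient is kept back to absorb the quadratic remainders. *)
pose c := Num.min `|alpha| `|alpha - beta| / 2.
have c_gt0 : 0 < c by rewrite divr_gt0 // lt_min na.
have ca : 2 * c <= `|alpha|.
  by rewrite /c mulrC divfK // ge_min lexx.
have cab : 2 * c <= `|alpha - beta|.
  by rewrite /c mulrC divfK // ge_min lexx orbT.
pose C := C3 + C4 + C5 + `|alpha| + `|alpha - beta| + c.
have C_gt0 : 0 < C by rewrite /C; lra.
(* The entry with [C1 + C2] bounds both remainders together by [c * e]; the factor 2 in the last one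
   makes [C ^+ 2 * e < c] strict. *)
pose eta := \big[Num.min/eta1]_(x <- [:: eta2; eta3; eta4; eta5;
  c / (C1 + C2); c / (2 * C ^+ 2)]) x.
have eta_gt0 : 0 < eta.
  rewrite /eta !big_cons big_nil !lt_min eta1_gt0 eta2_gt0 eta3_gt0 eta4_gt0 eta5_gt0.
  have g1 : 0 < c / (C1 + C2) by apply: divr_gt0 => //; exact: addr_gt0.
  have g2 : 0 < c / (2 * C ^+ 2) by apply: divr_gt0 => //; rewrite mulr_gt0 // exprn_gt0.
  by rewrite g1 g2.
exists C, c, eta; split => // e /andP[e0].
rewrite /eta !big_cons big_nil !le_min.
move=> /andP[e2 /andP[e3 /andP[e4 /andP[e5 /andP[e6 /andP[e7 e1]]]]]].
have {h1} := h1 e; have {h2} := h2 e; have {h3} := h3 e; have {h4} := h4 e; have {h5} := h5 e.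
rewrite e0 e1 e2 e3 e4 e5 tB0 tBA0 dB0 (gtr0_norm e0) (ger0_norm (sqr_ge0 e)) opprK addNr subr0.
move=> /(_ isT) h5 /(_ isT) h4 /(_ isT) h3 /(_ isT) h2 /(_ isT) h1.
have ce : (C1 + C2) * e ^+ 2 <= c * e.
  by rewrite expr2 mulrA ler_pM2r // mulrC -ler_pdivlMr // addr_gt0.
have Ce : C ^+ 2 * e < c.
  have CC_gt0 : 0 < C ^+ 2 by rewrite exprn_gt0.
  rewrite mulrC -ltr_pdivlMr //; apply: le_lt_trans e7 _.
  by rewrite ltr_pM2l // ltf_pV2 ?posrE ?mulr_gt0 // ltr_pMl // ltr1n.
clear - h1 h2 h3 h4 h5 ce Ce e0 a0 ab ca cab c_gt0 C1_gt0 C2_gt0 C3_gt0 C4_gt0 C5_gt0 na nab.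
have mono D : D <= C -> D * e <= C * e by rewrite ler_pM2r.
have q1 : 0 <= C1 * e ^+ 2 by rewrite mulr_ge0 ?sqr_ge0 // ltW.
have q2 : 0 <= C2 * e ^+ 2 by rewrite mulr_ge0 ?sqr_ge0 // ltW.
have aE : `|alpha * e| = `|alpha| * e by rewrite normrM (gtr0_norm e0).
have abE : `|(alpha - beta) * e| = `|alpha - beta| * e by rewrite normrM (gtr0_norm e0).
have sg_lb (x y : R) : x != 0 -> - `|y| <= Num.sg x * y.
  by move=> x0; have := ler_norm (- (Num.sg x * y));
  rewrite normrN normrM normr_sg x0 mul1r; lra.
have c_e : 0 <= c * e by rewrite ltW // mulr_gt0.
split=> //; split.
- by apply: le_trans h3 (mono _ _); rewrite /C; lra.
- by apply: le_trans h4 (mono _ _); rewrite /C; lra.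
- by apply: le_trans h5 (mono _ _); rewrite /C; lra.
- apply: (@le_trans _ _ ((`|alpha| + c) * e)); last by apply: mono; rewrite /C; lra.
  have -> : \det (A e) - 1 = (\det (A e) - (1 + alpha * e)) + alpha * e by ring.
  by apply: le_trans (ler_normD _ _) _; rewrite aE; lra.
split.
- apply: (@le_trans _ _ ((`|alpha - beta| + c) * e)); last by apply: mono; rewrite /C; lra.
  have -> : \tr (A e) - 1 - \det (A e) = (\tr (A e) - (2 + beta * e))
     - (\det (A e) - (1 + alpha * e)) - (alpha - beta) * e by ring.
  apply: le_trans (ler_normB _ _) _; rewrite abE.
  have := ler_normB (\tr (A e) - (2 + beta * e)) (\det (A e) - (1 + alpha * e)); lra.
- have -> : 1 + \det (A e) - \tr (A e) = (alpha - beta) * e -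
    ((\tr (A e) - (2 + beta * e)) - (\det (A e) - (1 + alpha * e))) by ring.
  rewrite mulrBr mulrA -normrEsg.
  have := sg_lb (alpha - beta)
    (- (\tr (A e) - (2 + beta * e) - (\det (A e) - (1 + alpha * e)))).
  rewrite subr_eq0 normrN => /(_ ab).
  have := ler_normB (\tr (A e) - (2 + beta * e)) (\det (A e) - (1 + alpha * e)).
  have := ler_wpM2r (ltW e0) cab; lra.
- have -> : \det (A e) - 1 = alpha * e + (\det (A e) - (1 + alpha * e)) by ring.
  rewrite mulrDr mulrA -normrEsg.
  have := sg_lb alpha (\det (A e) - (1 + alpha * e)) a0.
  have := ler_wpM2r (ltW e0) ca; lra.
Qed.

(** * Polar form of the eigenvalues and its expansion *)

(** The eigenvalues are [(\tr B +- i q) / 2] with [q ^+ 2 = 4 * \det B - \tr B ^+ 2]. Their real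
    part is positive, so the arctangent gives the argument. *)
Lemma eigenvalue_polar (R : realType) (B : 'M[R]_2) (z : R[i]) :
  0 < \tr B -> \tr B ^+ 2 < 4 * \det B ->
  let r := Num.sqrt (\det B) in
  let theta := atan (Num.sqrt (4 * \det B - \tr B ^+ 2) / \tr B) in
  complex_eigenvalue B z <-> (z = r%:C * expi theta \/ z = r%:C * expi (- theta)).
Proof.
move=> t0 disc r theta.
have [q q0 q2] : exists2 q, q = Num.sqrt (4 * \det B - \tr B ^+ 2) &
    q ^+ 2 = 4 * \det B - \tr B ^+ 2.
  by exists (Num.sqrt (4 * \det B - \tr B ^+ 2)); rewrite // sqr_sqrtr // subr_ge0 ltW.
have d0 : 0 < \det B by nra.
have r0 : 0 < r by rewrite sqrtr_gt0.
have r2 : r ^+ 2 = \det B by rewrite sqr_sqrtr // ltW.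
have cosE : cos theta = \tr B / (2 * r).
  rewrite /theta -q0 cos_atan.
  have -> : 1 + (q / \tr B) ^+ 2 = (2 * r / \tr B) ^+ 2.
    rewrite !expr_div_n q2 exprMn r2; field; exact: lt0r_neq0.
  rewrite sqrtr_sqr ger0_norm ?invf_div // divr_ge0 ?ltW //.
  by rewrite mulr_gt0.
have sinE : sin theta = q / (2 * r).
  have : tan theta = q / \tr B by rewrite /theta -q0 atanK.
  have c0 : cos theta != 0.
    by rewrite cosE mulf_neq0 ?invr_neq0 ?mulf_neq0 ?lt0r_neq0.
  rewrite /tan => /(congr1 (fun x => x * cos theta)); rewrite divfK // => ->.
  by rewrite cosE; field; rewrite !lt0r_neq0.
have zE : r%:C * expi theta = (\tr B / 2) +i* (q / 2).
  rewrite /expi cosE sinE; apply/eqP; rewrite eq_complex /=.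
  by apply/andP; split; apply/eqP; field; rewrite lt0r_neq0.
have zNE : r%:C * expi (- theta) = (\tr B / 2) +i* (- (q / 2)).
  rewrite /expi cosN sinN cosE sinE; apply/eqP; rewrite eq_complex /=.
  by apply/andP; split; apply/eqP; field; rewrite lt0r_neq0.
rewrite zE zNE {zE zNE}; case: z => a b; split.
  case/complex_eigenvalue_ReIm => e1 /eqP; rewrite mulf_eq0 => /orP[/eqP b0|/eqP h].
    exfalso; rewrite b0 in e1; have := sqr_ge0 (2 * a - \tr B); nra.
  have aE : a = \tr B / 2 by lra.
  have : (b - q / 2) * (b + q / 2) == 0 by rewrite aE in e1; apply/eqP; nra.
  rewrite mulf_eq0 aE => /orP[]; rewrite ?subr_eq0 ?addr_eq0 => /eqP ->; [by left|by right].
have aux (y : R) : y ^+ 2 = q ^+ 2 / 4 -> complex_eigenvalue B ((\tr B / 2) +i* y).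
  move=> y2; apply/complex_eigenvalue_ReIm; split; last by field.
  by rewrite y2 q2; field.
by case=> ->; apply: aux; field.
Qed.

(** The difference of the squares of [Num.sqrt d] and [1 + a / 2 * e] is of order [e ^+ 2], and
    their sum is at least 1/2. *)
Lemma sqrt_one_expansion (R : realType) (d a C e : R) :
  0 <= e -> `|a| * e <= 1 -> `|d - (1 + a * e)| <= C * e ^+ 2 -> 0 <= d ->
  `|Num.sqrt d - (1 + a / 2 * e)| <= (2 * C + a ^+ 2) * e ^+ 2.
Proof.
move=> e0 ae h d0.
set r := Num.sqrt d; have r0 : 0 <= r by exact: sqrtr_ge0.
have r2 : r ^+ 2 = d by rewrite sqr_sqrtr.
have ae' : -1 <= a * e.
  have : `|a * e| <= 1 by rewrite normrM (ger0_norm e0).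
  by move/ler_normlP => [? _]; lra.
have p : 2^-1 <= r + (1 + a / 2 * e) by lra.
have : `|(r - (1 + a / 2 * e)) * (r + (1 + a / 2 * e))| <= (C + a ^+ 2 / 4) * e ^+ 2.
  have -> : (r - (1 + a / 2 * e)) * (r + (1 + a / 2 * e)) =
    (d - (1 + a * e)) - a ^+ 2 / 4 * e ^+ 2 by rewrite -r2; field.
  apply: le_trans (ler_normB _ _) _; rewrite mulrDl; apply: lerD => //.
  by rewrite ger0_norm // mulr_ge0 ?sqr_ge0 // divr_ge0 ?sqr_ge0.
rewrite normrM (gtr0_norm (lt_le_trans _ p)) ?invr_gt0 // => h2.
have := ler_wpM2l (normr_ge0 (r - (1 + a / 2 * e))) p.
have : 0 <= a ^+ 2 * e ^+ 2 by rewrite mulr_ge0 ?sqr_ge0.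
lra.
Qed.

(** For nonnegative numbers [|x - y| <= x + y], so [(x - y) ^+ 2] is at most the distance of the
    squares; no lower bound on [x + y] enters. *)
Lemma dist_le_sqrt (R : realType) (x y K : R) : 0 <= x -> 0 <= y -> 0 <= K ->
  `|x ^+ 2 - y ^+ 2| <= K ^+ 2 -> `|x - y| <= K.
Proof.
move=> x0 y0 K0 /ler_normlP[h1 h2]; rewrite ler_norml; apply/andP; split; nra.
Qed.

(** With [q] the square root, three replacements cost O(e) each: [atan (q / t)] by [q / t], as
    [q ^+ 2] is O(e); [t] by 2; and [q / 2] by the square root of [g * e], as their squares differ
    by O(e^2). *)
Lemma angle_expansion (R : realType) (t d g C e : R) :
  0 < C -> 0 <= g -> 0 < e -> 1 <= t -> (g + C + C ^+ 2) * e <= 1 -> 0 <= 4 * d - t ^+ 2 ->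
  `|t - 2| <= C * e -> `|1 + d - t - g * e| <= C * e ^+ 2 -> e <= 1 ->
  `|atan (Num.sqrt (4 * d - t ^+ 2) / t) - Num.sqrt g * Num.sqrt e|
    <= (8 * g + 10 * C + 4 * C ^+ 2 + 1) * e.
Proof.
move=> C0 g0 e0 t1 small disc ht hg e1.
set q := Num.sqrt _; have q0 : 0 <= q by exact: sqrtr_ge0.
have q2 : q ^+ 2 = 4 * d - t ^+ 2 by rewrite sqr_sqrtr.
set w := _ * Num.sqrt e; have w0 : 0 <= w by rewrite mulr_ge0 ?sqrtr_ge0.
have w2 : w ^+ 2 = g * e by rewrite exprMn !sqr_sqrtr // ltW.
have ee : e ^+ 2 <= e by rewrite expr2; nra.
have tt : (t - 2) ^+ 2 <= C ^+ 2 * e ^+ 2.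
  by rewrite -exprMn -[leLHS]real_normK ?num_real // lerXn2r ?nnegrE ?mulr_ge0 // ltW.
have tt0 := sqr_ge0 (t - 2).
have C2 := sqr_ge0 C.
have qE : q ^+ 2 = 4 * (1 + d - t) - (t - 2) ^+ 2 by rewrite q2; ring.
have C2e : C ^+ 2 * e ^+ 2 <= C ^+ 2 * e by rewrite ler_wpM2l.
have Cee : C * e ^+ 2 <= C * e by rewrite ler_pM2l.
have qle : q ^+ 2 <= (4 * g + 4 * C) * e.
  by rewrite qE; move/ler_normlP: hg => [? ?]; lra.
have x0 : 0 <= q / t by rewrite divr_ge0 // (le_trans _ t1).
have xq : q / t <= q by rewrite ler_pdivrMr ?ler_peMr // (lt_le_trans _ t1).
have b1 : `|atan (q / t) - q / t| <= (4 * g + 4 * C) * e.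
  apply: le_trans (atan_bound x0) (le_trans _ qle).
  by rewrite lerXn2r ?nnegrE.
have q_le2 : q <= 2.
  have : 0 <= C ^+ 2 * e by rewrite mulr_ge0 // ltW.
  nra.
have b2 : `|q / t - q / 2| <= C * e.
  have -> : q / t - q / 2 = - ((q / t / 2) * (t - 2))
    by field; rewrite lt0r_neq0 // (lt_le_trans _ t1).
  have x2 : 0 <= q / t / 2 by rewrite divr_ge0.
  rewrite normrN normrM (ger0_norm x2) -[leRHS]mul1r.
  by apply: ler_pM => //; lra.
have b3 : `|q / 2 - w| <= (C + C ^+ 2 + 1) * e.
  apply: dist_le_sqrt => //; first by rewrite divr_ge0.
    by rewrite mulr_ge0 ?(ltW e0) //; lra.
  have -> : (q / 2) ^+ 2 - w ^+ 2 = (1 + d - t - g * e) - (t - 2) ^+ 2 / 4.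
    by rewrite expr_div_n qE w2; field.
  apply: le_trans (ler_normB _ _) _.
  rewrite (ger0_norm (_ : 0 <= (t - 2) ^+ 2 / 4)) ?divr_ge0 // exprMn.
  (* The summand 1 makes the constant at least 1, hence at most its own square, as [dist_le_sqrt]
     requires. *)
  have : (C + C ^+ 2 + 1) * e ^+ 2 <= (C + C ^+ 2 + 1) ^+ 2 * e ^+ 2.
    by apply: ler_wpM2r; rewrite ?sqr_ge0 //; nra.
  have := sqr_ge0 e; lra.
have -> : atan (q / t) - w = (atan (q / t) - q / t) + (q / t - q / 2) + (q / 2 - w) by ring.
apply: le_trans (ler_normD _ _) _.
have := ler_normD (atan (q / t) - q / t) (q / t - q / 2).
have : 0 <= C ^+ 2 * e by rewrite mulr_ge0 // ltW.
have : 0 <= C * e by rewrite mulr_ge0 // ltW.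
have : 0 <= g * e by rewrite mulr_ge0 // ltW.
lra.
Qed.

Lemma eigenvalue_polar_expansion (R : realType) (A : R -> 'M[R]_2)
    (alpha beta C eta : R) :
  0 < C -> 0 < eta -> 0 <= alpha - beta ->
  (forall e, 0 < e <= eta ->
     `|\det (A e) - 1| <= C * e /\ `|\tr (A e) - 1 - \det (A e)| <= C * e) ->
  (forall e, 0 < e <= eta -> \tr (A e) ^+ 2 < 4 * \det (A e)) ->
  (fun e => \det (A e)) = (fun e => 1 + alpha * e) +O_ (nbhs (0 : R)) (fun e => e ^+ 2) ->
  (fun e => \tr (A e)) = (fun e => 2 + beta * e) +O_ (nbhs (0 : R)) (fun e => e ^+ 2) ->
  exists r theta : R -> R,
    [/\ \forall e \near (0 : R)^'+, forall z : R[i],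
          complex_eigenvalue (A e) z <->
          (z = (r e)%:C * expi (theta e) \/ z = (r e)%:C * expi (- theta e)),
        r = (fun e : R => 1 + alpha / 2 * e) +O_ ((0 : R)^'+) (fun e : R => e ^+ 2) &
        theta = (fun e : R => Num.sqrt (alpha - beta) * Num.sqrt e)
          +O_ ((0 : R)^'+) (fun e : R => e)].
Proof.
move=> C0 eta0 g0 est disc detO trO.
have [C1 C1_gt0 n1] := eqaddO_near0 detO; have [eta1 eta1_gt0 {n1} n1] := near0_pos n1.
have [C2 C2_gt0 n2] := eqaddO_near0 trO; have [eta2 eta2_gt0 {n2} n2] := near0_pos n2.
pose g := alpha - beta; pose C' := 2 * C + C1 + C2.
have C'_gt0 : 0 < C' by rewrite /C'; lra.
(* [D * e <= 1] implies all the smallness conditions of the two expansions at once. *)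
pose D := g + C' + C' ^+ 2 + `|alpha| + 1.
have C'2 := sqr_ge0 C'; have na := normr_ge0 alpha; have g0' : 0 <= g by [].
have D_gt0 : 0 < D by rewrite /D; lra.
pose eta' := Num.min (Num.min eta D^-1) (Num.min eta1 eta2).
have eta'_gt0 : 0 < eta' by rewrite !lt_min eta0 invr_gt0 D_gt0 eta1_gt0.
have small e : 0 < e <= eta' -> [/\ 0 < e <= eta, D * e <= 1,
    `|\det (A e) - (1 + alpha * e)| <= C1 * e ^+ 2 &
    `|\tr (A e) - (2 + beta * e)| <= C2 * e ^+ 2].
  rewrite !le_min => /andP[e0 /andP[/andP[e1 e2] /andP[e3 e4]]].
  have := n1 e; have := n2 e; rewrite e0 e1 e3 e4 (ger0_norm (sqr_ge0 e)).
  move=> /(_ isT) h2 /(_ isT) h1; split => //.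
  by rewrite mulrC -ler_pdivlMr // div1r.
have De e : 0 < e <= eta' ->
    [/\ e <= 1, `|alpha| * e <= 1, (g + C' + C' ^+ 2) * e <= 1 & C' * e <= 1].
  move=> he; have [/andP[e0' _] De _ _] := small e he.
  clear - C'2 na g0' C'_gt0 De e0'.
  have le_D x : x <= D -> x * e <= 1 by move=> xD; apply: le_trans De; rewrite ler_pM2r.
  by split; [rewrite -[e]mul1r| | |]; apply: le_D; rewrite /D; lra.
have trA e : 0 < e <= eta' -> `|\tr (A e) - 2| <= C' * e /\ 1 <= \tr (A e).
  move=> he; have [he' _ _ _] := small e he; have [_ _ _ Ce1] := De e he.
  have [bd bt] := est e he'.
  have e0 : 0 < e by case/andP: he.
  have le1 : `|\tr (A e) - 2| <= C' * e.
    have -> : \tr (A e) - 2 = (\tr (A e) - 1 - \det (A e)) + (\det (A e) - 1) by ring.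
    apply: le_trans (ler_normD _ _) (le_trans (lerD bt bd) _).
    by rewrite -mulrDl ler_pM2r // /C'; lra.
  by split=> //; move/ler_normlP: le1 => [? ?]; lra.
have detA e : 0 < e <= eta' -> \tr (A e) ^+ 2 < 4 * \det (A e).
  by move=> he; have [he' _ _ _] := small e he; exact: disc.
exists (fun e => Num.sqrt (\det (A e))),
  (fun e => atan (Num.sqrt (4 * \det (A e) - \tr (A e) ^+ 2) / \tr (A e))); split.
- apply: near_right0 eta'_gt0 _ => e he z; apply: eigenvalue_polar; last exact: detA.
  by have [_ t1] := trA e he; exact: lt_le_trans t1.
- apply: (@eqaddO_right0 _ _ _ _ (2 * C1 + alpha ^+ 2) eta') => //.
    by rewrite ltr_pwDl ?sqr_ge0 // mulr_gt0.
  move=> e he; rewrite (ger0_norm (sqr_ge0 e)).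
  have [/andP[e0 _] _ dE _] := small e he; have [_ ae _ _] := De e he.
  apply: sqrt_one_expansion => //; first exact: ltW.
  by have := sqr_ge0 (\tr (A e)); have := detA e he; lra.
- apply: (@eqaddO_right0 _ _ _ _ (8 * g + 10 * C' + 4 * C' ^+ 2 + 1) eta') => //.
    by lra.
  move=> e he; have [/andP[e0 _] _ dE tE] := small e he; have [e1 _ Ce _] := De e he.
  have [t2 t1] := trA e he; rewrite (gtr0_norm e0).
  apply: angle_expansion => //; first by rewrite subr_ge0 ltW // detA.
  have -> : 1 + \det (A e) - \tr (A e) - g * e =
      (\det (A e) - (1 + alpha * e)) - (\tr (A e) - (2 + beta * e)) by rewrite /g; ring.
  apply: le_trans (ler_normB _ _) (le_trans (lerD dE tE) _).
  by rewrite -mulrDl ler_wpM2r ?sqr_ge0 // /C'; lra.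
Qed.

(** * The equivalences, read off from two signs *)

Theorem theorem5p1 (R : realType) (mu : R) (tau delta : symbol -> R -> R)
    (X Y : word) (alpha beta : R) :
  mu != 0 ->
  (forall J : symbol, smooth_near0 (tau J) /\ smooth_near0 (delta J)) ->
  X <> [::] -> Y <> [::] -> primitive X -> nth SymL X 0 <> nth SymL Y 0 ->
  infinite_set [set k : nat | (1 <= k)%N /\
    has_unique_admissible_stable_cycle (tau^~ 0) (delta^~ 0) mu
      (word_pow_cat X Y k)] ->
  repeated_unit_eigenvalue_geom1 (word_mx (tau^~ 0) (delta^~ 0) X) ->
  delta SymL 0 = 1 -> delta SymR 0 = 1 ->
  (fun e : R => \det (word_mx (tau^~ e) (delta^~ e) X))
    = (fun e : R => 1 + alpha * e) +O_ (nbhs (0 : R)) (fun e : R => e ^+ 2) ->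
  (fun e : R => \tr (word_mx (tau^~ e) (delta^~ e) X))
    = (fun e : R => 2 + beta * e) +O_ (nbhs (0 : R)) (fun e : R => e ^+ 2) ->
  alpha != 0 -> alpha != beta ->
  [<-> beta < alpha < 0;
       exists2 es : R, 0 < es & forall e : R, 0 < e <= es ->
         forall z : R[i],
           complex_eigenvalue (word_mx (tau^~ e) (delta^~ e) X) z ->
           complex.Im z != 0 /\ `|z| < 1;
       exists (kmin : int) (Delta : R), 0 < Delta /\
         forall k : nat, (1 <= k)%N -> kmin <= k%:Z ->
         forall e : R, 0 < e <= Delta * k%:R ^- 2 ->
         forall z : R[i],
           complex_eigenvalue
             (word_mx (tau^~ e) (delta^~ e) (word_pow_cat X Y k)) z ->
           `|z| < 1]
  /\
  (beta < alpha < 0 ->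
     exists r theta : R -> R,
       [/\ \forall e \near (0 : R)^'+, forall z : R[i],
             complex_eigenvalue (word_mx (tau^~ e) (delta^~ e) X) z <->
             (z = (r e)%:C * expi (theta e) \/
              z = (r e)%:C * expi (- theta e)),
           r = (fun e : R => 1 + alpha / 2 * e)
             +O_ ((0 : R)^'+) (fun e : R => e ^+ 2) &
           theta = (fun e : R => Num.sqrt (alpha - beta) * Num.sqrt e)
             +O_ ((0 : R)^'+) (fun e : R => e)]).
Proof.
move=> _ sm X0 _ _ _ infk rep dL dR detO trO a0 ab.
have d1 J : delta J 0 = 1 by case: J.
(* Order 0 of smoothness at the point 0 is derivability of the function itself. *)
have dt J : derivable (tau J) 0 1 by exact: (nbhs_singleton (sm J).1 0%N).
have dd J : derivable (delta J) 0 1 by exact: (nbhs_singleton (sm J).2 0%N).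
pose A e := word_mx (tau^~ e) (delta^~ e) X.
pose B e := word_mx (tau^~ e) (delta^~ e) Y.
have [tB0 tBA0] := resonance_traces X0 d1 infk rep.
have detB0 : \det (B 0) = 1 by exact: det_word_mx_eq1.
have [C [c [eta [C0 c0 eta0 est]]]] := @resonant_near0 R A B alpha beta
  (fun _ _ => derivable_word_mx dt dd) (fun _ _ => derivable_word_mx dt dd)
  tB0 tBA0 detB0 detO trO a0 ab.
set s := Num.sg (alpha - beta) in est; set sd := Num.sg alpha in est.
have s2 : s ^+ 2 = 1 by rewrite sqr_sg subr_eq0 ab.
have sd2 : sd ^+ 2 = 1 by rewrite sqr_sg a0.
have sC (x : R) : x ^+ 2 = 1 -> x = 1 \/ x = -1.
  by move/eqP; rewrite sqrf_eq1 => /orP[] /eqP ->; [left|right].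
have iE : beta < alpha < 0 <-> s = 1 /\ sd = -1.
  rewrite -subr_gt0 -sgr_gt0 -[alpha < 0]sgr_lt0 -/s -/sd; split.
    by move=> /andP[]; case: (sC _ s2) => ->; case: (sC _ sd2) => ->; lra.
  by move=> [-> ->]; rewrite ltr01 oppr_lt0 ltr01.
have NR e : 0 < e <= eta -> (s = 1 -> \tr (A e) ^+ 2 < 4 * \det (A e)) /\
    (s = -1 -> 4 * \det (A e) < \tr (A e) ^+ 2).
  move=> he; have [[_ _ _ dA [gA lb _]] Ce] := est e he; case/andP: he => e0 _.
  exact: nonreal_disc C0 e0 dA gA Ce lb.
have dA e : 0 < e <= eta -> 0 < sd * (\det (A e) - 1).
  move=> he; have [[_ _ _ _ [_ _ lb]] _] := est e he; case/andP: he => e0 _.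
  by apply: lt_le_trans lb; exact: mulr_gt0.
have [K [Delta [K0 D0 word_est]]] := resonant_word_estimates C0 c0 eta0 s2 sd2
  (fun e he => (est e he).1).
clear sm infk rep dL dR d1 dt dd tB0 tBA0 detB0.
split.
tfae.
- move=> /iE[sE sdE]; exists eta => // e he z.
  apply: (nonreal_stableP _).2; split; first exact: (NR e he).1.
  by have := dA e he; rewrite sdE; lra.
(* The signs [s] and [sd] do not depend on [e], so one value of [e] in both ranges determines
   them. *)
- move=> [es es0 h]; have hmin : 0 < Num.min es eta <= eta.
    by rewrite lt_min es0 eta0 ge_min lexx orbT.
  have [|disc det_lt1] := (nonreal_stableP (A (Num.min es eta))).1.
    by apply: h; rewrite lt_min es0 eta0 ge_min lexx.
  have [sE sdE] : s = 1 /\ sd = -1.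
    split.
      by case: (sC _ s2) => // /(NR _ hmin).2; lra.
    by case: (sC _ sd2) => // sdE; have := dA _ hmin; rewrite sdE; lra.
  exists K%:Z, Delta; split=> // k _ Kk e he.
  have [] := word_est k e Kk he; rewrite -word_mx_pow_cat sE sdE => p1 p2 p3 p4.
  (* The trace is at most -1 and the determinant at least 1/2, which gives the remaining bound
     [\tr M < 1 + \det M]. *)
  move/ler_normlP: p3 => [p3 p3']; move/ler_normlP: p4 => [p4 p4'].
  apply: jury_sufficient; first by lra.
  by rewrite ltr_norml; apply/andP; split; lra.
- move=> [kmin [Delta' [D0' h]]]; apply/iE.
  (* One [k] past both thresholds and one [e] in both ranges suffice: a wrong sign in [word_est]
     would contradict Jury's necessary conditions there. *)
  pose k := maxn K `|kmin|%N.
  pose e := Num.min Delta Delta' * k%:R ^- 2.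
  have Kk : (K <= k)%N by rewrite leq_maxl.
  have k2 : 0 < k%:R ^- 2 :> R by rewrite invr_gt0 exprn_gt0 // ltr0n (leq_trans K0).
  have e0 : 0 < e by rewrite mulr_gt0 // lt_min D0.
  have he : 0 < e <= Delta * k%:R ^- 2 by rewrite e0 ler_pM2r // ge_min lexx.
  have he' : 0 < e <= Delta' * k%:R ^- 2 by rewrite e0 ler_pM2r // ge_min lexx orbT.
  have kk : kmin <= k%:Z.
    by apply: le_trans (ler_norm _) _; rewrite -abszE lez_nat leq_maxr.
  have := jury_necessary (h k (leq_trans K0 Kk) kk e he').
  have [] := word_est k e Kk he; rewrite -word_mx_pow_cat => p1 p2 _ _ [q1 q2].
  split.
    by case: (sC _ s2) => // sE; rewrite sE in p1; lra.
  by case: (sC _ sd2) => // sE; rewrite sE in p2; lra.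
move=> /iE[sE _]; apply: eigenvalue_polar_expansion C0 eta0 _ _ _ detO trO.
- by rewrite ltW // -sgr_gt0 -/s sE.
- by move=> e /est[[_ _ _ bd [bt _ _]] _].
- by move=> e he; exact: (NR e he).1.
Qed.
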